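(* Let $\Omega_1,\Omega_2\subset\mathbb{H}_s^n$, where $\Omega_1$ is real-path-connected and $\Omega_2$ is $\Omega_1$-stem-preserving, and let $f:\Omega_2\to\mathbb{H}$ be path-slice. Then the function $F_{\Omega_1}^f:\mathscr{P}(\mathbb{C}^n,\Omega_1)\to\mathbb{H}^{2\times 1}$ given by $$F_{\Omega_1}^f(\gamma):=\begin{pmatrix}1&I\\1&J\end{pmatrix}^{-1}\begin{pmatrix}f(\gamma^I(1))\\ f(\gamma^J(1))\end{pmatrix},$$ where $I,J$ are arbitrary elements of $\mathbb{S}(\Omega_2,\gamma)$ with $I\neq J$, is well-defined (independent of the choice of $I\ne J$). Moreover, if $F$ is a path-slice stem function of $f$, then $F_{\Omega_1}^f=F|_{\mathscr{P}(\mathbb{C}^n,\Omega_1)}$.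
   Context: Let $n$ be a positive integer, $\mathbb{H}$ the quaternions, $\mathbb{S}:=\{I\in\mathbb{H}: I^2=-1\}$, $\mathbb{C}_I:=\mathbb{R}+\mathbb{R}I$, $\mathbb{C}_I^n:=(\mathbb{C}_I)^n$ and $\mathbb{H}_s^n:=\bigcup_{I\in\mathbb{S}}\mathbb{C}_I^n\subset\mathbb{H}^n$. For $I\in\mathbb{S}$ let $\Psi_i^I:\mathbb{C}^n\to\mathbb{C}_I^n$, $x+yi\mapsto x+yI$ ($x,y\in\mathbb{R}^n$). Let $\mathscr{P}(\mathbb{C}^n)$ be the set of continuous paths $\gamma:[0,1]\to\mathbb{C}^n$ with $\gamma(0)\in\mathbb{R}^n$; put $\gamma^I:=\Psi_i^I\circ\gamma$, and write $\gamma^I\subset\Omega$ if $\gamma^I([0,1])\subset\Omega$. For $\Omega\subset\mathbb{H}_s^n$ let $\mathscr{P}(\mathbb{C}^n,\Omega):=\{\gamma\in\mathscr{P}(\mathbb{C}^n):\exists I\in\mathbb{S},\ \gamma^I\subset\Omega\}$, and for $\gamma\in\mathscr{P}(\mathbb{C}^n)$ let $\mathbb{S}(\Omega,\gamma):=\{I\in\mathbb{S}:\gamma^I\subset\Omega\}$. A function $f:\Omega\to\mathbb{H}$ is path-slice if there is a function $F:\mathscr{P}(\mathbb{C}^n,\Omega)\to\mathbb{H}^{2\times1}$ with $f(\gamma^I(1))=(1,I)F(\gamma)$ for all $\gamma\in\mathscr{P}(\mathbb{C}^n,\Omega)$ and $I\in\mathbb{S}(\Omega,\gamma)$; any such $F$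 is called a path-slice stem function of $f$. $\Omega$ is real-path-connected if for every $q\in\Omega$ there are $\gamma\in\mathscr{P}(\mathbb{C}^n,\Omega)$ and $I\in\mathbb{S}(\Omega,\gamma)$ with $\gamma^I(1)=q$. $\Omega_2$ is $\Omega_1$-stem-preserving if (i) $|\mathbb{S}(\Omega_2,\gamma)|\geq 2$ for every $\gamma\in\mathscr{P}(\mathbb{C}^n,\Omega_1)$, and (ii) $|\mathbb{S}(\Omega_2,\alpha)\cap\mathbb{S}(\Omega_2,\beta)|\neq 1$ for all $\alpha,\beta\in\mathscr{P}(\mathbb{C}^n,\Omega_1)$ with $\alpha(1)=\beta(1)$. (In particular $\mathscr{P}(\mathbb{C}^n,\Omega_1)\subseteq\mathscr{P}(\mathbb{C}^n,\Omega_2)$, so the restriction in the claim makes sense.) For $I\ne J$ in $\mathbb{S}$, $\begin{pmatrix}1&I\\1&J\end{pmatrix}^{-1}=(I-J)^{-1}\begin{pmatrix}I&-J\\1&-1\end{pmatrix}$. *)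

(* Defs.v *)
From HB Require Import structures.
From mathcomp Require Import all_boot all_order all_algebra.
From mathcomp Require Import complex.
From mathcomp Require Import all_classical all_reals all_analysis.
From mathcomp Require Import ring lra.

Set Implicit Arguments.
Unset Strict Implicit.
Unset Printing Implicit Defensive.

Import Order.TTheory GRing.Theory Num.Theory.
Import numFieldNormedType.Exports.

Local Open Scope ring_scope.
Local Open Scope classical_set_scope.

(** Hamilton quaternions [q0 + q1 i + q2 j + q3 k]. *)

Record quaternion (R : Type) : Type :=
  Quaternion { quat0 : R; quat1 : R; quat2 : R; quat3 : R }.

Section QuaternionEncoding.
Variable R : Type.

Definition quat_enc (q : quaternion R) : R * R * R * R :=
  (quat0 q, quat1 q, quat2 q, quat3 q).

Definition quat_dec (t : R * R * R * R) : quaternion R :=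
  let: (a, b, c, d) := t in Quaternion a b c d.

Lemma quat_encK : cancel quat_enc quat_dec.
Proof. by case. Qed.

End QuaternionEncoding.

HB.instance Definition _ (R : eqType) :=
  Equality.copy (quaternion R) (can_type (@quat_encK R)).
HB.instance Definition _ (R : choiceType) :=
  Choice.copy (quaternion R) (can_type (@quat_encK R)).

Section QuaternionRing.
Variable R : realFieldType.
Implicit Types p q r : quaternion R.

Lemma quatP p q :
  quat0 p = quat0 q -> quat1 p = quat1 q ->
  quat2 p = quat2 q -> quat3 p = quat3 q -> p = q.
Proof. by case: p => ? ? ? ?; case: q => ? ? ? ? /= -> -> -> ->. Qed.

Definition quat_zero : quaternion R := Quaternion 0 0 0 0.

Definition quat_opp q : quaternion R :=
  Quaternion (- quat0 q) (- quat1 q) (- quat2 q) (- quat3 q).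

Definition quat_add p q : quaternion R :=
  Quaternion (quat0 p + quat0 q) (quat1 p + quat1 q)
             (quat2 p + quat2 q) (quat3 p + quat3 q).

Lemma quat_addA : associative quat_add.
Proof. by move=> p q r; apply: quatP => /=; ring. Qed.

Lemma quat_addC : commutative quat_add.
Proof. by move=> p q; apply: quatP => /=; ring. Qed.

Lemma quat_add0 : left_id quat_zero quat_add.
Proof. by move=> p; apply: quatP => /=; ring. Qed.

Lemma quat_addN : left_inverse quat_zero quat_opp quat_add.
Proof. by move=> p; apply: quatP => /=; ring. Qed.

HB.instance Definition _ := GRing.isZmodule.Build (quaternion R)
  quat_addA quat_addC quat_add0 quat_addN.

Definition quat_one : quaternion R := Quaternion 1 0 0 0.

Definition quat_mul p q : quaternion R :=
  let: Quaternion a b c d := p in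
  let: Quaternion a' b' c' d' := q in
  Quaternion (a * a' - b * b' - c * c' - d * d')
             (a * b' + b * a' + c * d' - d * c')
             (a * c' - b * d' + c * a' + d * b')
             (a * d' + b * c' - c * b' + d * a').

Lemma quat_mulA : associative quat_mul.
Proof.
by case=> ? ? ? ? [? ? ? ?] [? ? ? ?]; apply: quatP => /=; ring.
Qed.

Lemma quat_mul1q : left_id quat_one quat_mul.
Proof. by case=> ? ? ? ?; apply: quatP => /=; ring. Qed.

Lemma quat_mulq1 : right_id quat_one quat_mul.
Proof. by case=> ? ? ? ?; apply: quatP => /=; ring. Qed.

Lemma quat_mulDl : left_distributive quat_mul quat_add.
Proof.
by case=> ? ? ? ? [? ? ? ?] [? ? ? ?]; apply: quatP => /=; ring.
Qed.

Lemma quat_mulDr : right_distributive quat_mul quat_add.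
Proof.
by case=> ? ? ? ? [? ? ? ?] [? ? ? ?]; apply: quatP => /=; ring.
Qed.

Lemma quat_one_neq0 : quat_one != 0.
Proof. by apply/eqP => -[] /eqP; rewrite oner_eq0. Qed.

HB.instance Definition _ := GRing.Zmodule_isNzRing.Build (quaternion R)
  quat_mulA quat_mul1q quat_mulq1 quat_mulDl quat_mulDr quat_one_neq0.

Definition quat_normsq q : R :=
  quat0 q ^+ 2 + quat1 q ^+ 2 + quat2 q ^+ 2 + quat3 q ^+ 2.

Definition quat_inv q : quaternion R :=
  Quaternion (quat0 q / quat_normsq q) (- quat1 q / quat_normsq q)
             (- quat2 q / quat_normsq q) (- quat3 q / quat_normsq q).

Definition quat_unit : pred (quaternion R) := [pred q | q != 0].

Lemma quat_normsq_neq0 q : q != 0 -> quat_normsq q != 0.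
Proof.
apply: contraNneq; rewrite /quat_normsq; case: q => a b c d /= h.
apply/eqP; apply: quatP => /=; nra.
Qed.

Lemma quat_mulVq : {in quat_unit, left_inverse 1 quat_inv *%R}.
Proof.
move=> q /quat_normsq_neq0; rewrite /quat_inv /quat_normsq.
by case: q => a b c d /= h; apply: quatP => /=; field.
Qed.

Lemma quat_mulqV : {in quat_unit, right_inverse 1 quat_inv *%R}.
Proof.
move=> q /quat_normsq_neq0; rewrite /quat_inv /quat_normsq.
by case: q => a b c d /= h; apply: quatP => /=; field.
Qed.

Lemma quat_unitP p q : q * p = 1 /\ p * q = 1 -> quat_unit p.
Proof.
case=> + _; apply: contra_eqN => /eqP ->.
by rewrite mulr0 eq_sym oner_eq0.
Qed.

Lemma quat_inv_out : {in [predC quat_unit], quat_inv =1 id}.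
Proof.
move=> q; rewrite !inE negbK => /eqP ->.
by apply: quatP => /=; rewrite ?oppr0 mul0r.
Qed.

HB.instance Definition _ := GRing.NzRing_hasMulInverse.Build (quaternion R)
  quat_mulVq quat_mulqV quat_unitP quat_inv_out.

Lemma unit_quatE q : (q \is a GRing.unit) = (q != 0).
Proof. by []. Qed.

Definition quat_of_real (x : R) : quaternion R := Quaternion x 0 0 0.

End QuaternionRing.

Notation "x %:H" := (quat_of_real x)
  (at level 1, left associativity, format "x %:H") : ring_scope.

(** [R[i]] carries the topology of its norm. *)
HB.instance Definition _ (R : realType) :=
  Topological.copy R[i] R[i]^o.

Section SliceCone.
Variables (R : realType) (n : nat).
Local Notation H := (quaternion R).

Definition imag_units : set H := [set I | I ^+ 2 = - 1].

(* $\mathbb{C}_I$, $\mathbb{C}_I^n$ and $\mathbb{H}_s^n$ *)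
Definition slice_plane (I : H) : set H :=
  [set q | exists x y : R, q = x%:H + y%:H * I].

Definition slice_space (I : H) : set 'rV[H]_n :=
  [set q | forall j, slice_plane I (q 0 j)].

Definition slice_cone : set 'rV[H]_n :=
  \bigcup_(I in imag_units) slice_space I.

(* The map $\Psi_i^I$. *)
Definition slice_map (I : H) (z : 'rV[R[i]]_n) : 'rV[H]_n :=
  map_mx (fun w : R[i] => (complex.Re w)%:H + (complex.Im w)%:H * I) z.

Lemma slice_map_space (I : H) (z : 'rV[R[i]]_n) : slice_space I (slice_map I z).
Proof.
by move=> j; exists (complex.Re (z 0 j)), (complex.Im (z 0 j)); rewrite mxE.
Qed.

End SliceCone.

Arguments slice_cone : clear implicits.

Section Paths.
Variables (R : realType) (n : nat).
Local Notation H := (quaternion R).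

Definition unit_itv : set R := `[0, 1].

Lemma unit_itv_0 : 0 \in unit_itv.
Proof. by rewrite inE /unit_itv /= in_itv /= lexx ler01. Qed.

Lemma unit_itv_1 : 1 \in unit_itv.
Proof. by rewrite inE /unit_itv /= in_itv /= lexx ler01. Qed.

Definition itv0 : unit_itv := SigSub unit_itv_0.
Definition itv1 : unit_itv := SigSub unit_itv_1.

Local Notation curve := (unit_itv -> 'rV[R[i]]_n).
Implicit Types (Omega : set 'rV[H]_n) (g : curve) (I J : H).

(* $\mathscr{P}(\mathbb{C}^n)$ *)
Definition paths : set curve :=
  [set g : curve | continuous g /\ forall j, complex.Im (g itv0 0 j) = 0].

(* $\gamma^I$ *)
Definition slice_path I g : unit_itv -> 'rV[H]_n := slice_map I \o g.

(* $\mathbb{S}(\Omega,\gamma)$ *)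
Definition slice_units Omega g : set H :=
  [set I | imag_units I /\ range (slice_path I g) `<=` Omega].

(* $\mathscr{P}(\mathbb{C}^n,\Omega)$ *)
Definition paths_in Omega : set curve :=
  [set g | paths g /\ slice_units Omega g !=set0].

Lemma slice_end_in Omega g I :
  slice_units Omega g I -> slice_path I g itv1 \in Omega.
Proof. by case=> _ sub; apply/mem_set/sub; exists itv1. Qed.

(* $\gamma^I(1)$ as a point of $\Omega$ *)
Definition slice_end Omega g I (hI : slice_units Omega g I) : Omega :=
  SigSub (slice_end_in hI).

Definition path_slice_stem Omega (f : Omega -> H)
    (F : paths_in Omega -> 'cV[H]_2) : Prop :=
  forall (g : paths_in Omega) I (hI : slice_units Omega (\val g) I),
    f (slice_end hI) =
    (row_mx 1%:M I%:M *m (F g : 'cV[H]_(1 + 1))) 0 0.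

Definition path_slice Omega (f : Omega -> H) : Prop :=
  exists F : paths_in Omega -> 'cV[H]_2, path_slice_stem f F.

Definition real_path_connected Omega : Prop :=
  forall q, Omega q -> exists g I,
    [/\ paths_in Omega g, slice_units Omega g I & slice_path I g itv1 = q].

Definition stem_preserving Omega1 Omega2 : Prop :=
  (forall g, paths_in Omega1 g -> (`I_2 #<= slice_units Omega2 g)%card) /\
  (forall a b, paths_in Omega1 a -> paths_in Omega1 b -> a itv1 = b itv1 ->
    (slice_units Omega2 a `&` slice_units Omega2 b #!= `I_1)%card).

Lemma stem_preserving_paths Omega1 Omega2 :
  stem_preserving Omega1 Omega2 -> paths_in Omega1 `<=` paths_in Omega2.
Proof.
case=> card2 _ g g1; split; first by case: g1.
apply/set0P/eqP => S0; have := card2 _ g1.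
by rewrite S0 card_le0 => /eqP/seteqP[/(_ 0%N)+ _]; apply.
Qed.

(* The restriction of a function on $\mathscr{P}(\mathbb{C}^n,\Omega_2)$ to
   $\mathscr{P}(\mathbb{C}^n,\Omega_1)$. *)
Definition restrict_paths Omega1 Omega2 (h : stem_preserving Omega1 Omega2)
    (F : paths_in Omega2 -> 'cV[H]_2) : paths_in Omega1 -> 'cV[H]_2 :=
  F \o subfun (stem_preserving_paths h).

(* The matrix with rows $(1, I)$ and $(1, J)$, and its inverse for
   $I \ne J$; [invmx] is available only over commutative rings. *)
Definition slice_mx I J : 'M[H]_2 :=
  block_mx 1%:M I%:M 1%:M J%:M : 'M[H]_(1 + 1).

Definition slice_mxV I J : 'M[H]_2 :=
  (I - J)^-1 *: block_mx I%:M (- J)%:M 1%:M (- 1)%:M : 'M[H]_(1 + 1).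

Lemma slice_mxVK I J : imag_units I -> imag_units J -> I != J ->
  slice_mxV I J *m slice_mx I J = 1%:M.
Proof.
rewrite /imag_units /= !expr2 => I2 J2 neIJ.
have IJ_unit : I - J \is a GRing.unit by rewrite unit_quatE subr_eq0.
rewrite /slice_mxV /slice_mx -scalemxAl.
rewrite (@mulmx_block H 1 1 1 1 1 1).
rewrite -!scalar_mxM -!raddfD !(mulr1, mul1r) mulN1r mulNr I2 J2 !subrr /=.
by rewrite (@scale_block_mx _ 1 1 1 1) !scale_scalar_mx mulVr // mulr0 !raddf0 -scalar_mx_block.
Qed.

Lemma slice_mxKV I J : imag_units I -> imag_units J -> I != J ->
  slice_mx I J *m slice_mxV I J = 1%:M.
Proof.
rewrite /imag_units /= !expr2 => I2 J2 neIJ.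
have IJ_unit : I - J \is a GRing.unit by rewrite unit_quatE subr_eq0.
have swap A B : A * (I - J) = - ((I - J) * B) ->
    (I - J)^-1 * A = - (B * (I - J)^-1).
  move=> AB; apply: (mulrI IJ_unit); rewrite mulVKr // mulrN mulrA.
  by rewrite -mulNr -AB mulrK.
have VI : (I - J)^-1 * I = - (J * (I - J)^-1).
  by apply: swap; rewrite mulrBr mulrBl I2 J2 opprB.
have VJ : (I - J)^-1 * J = - (I * (I - J)^-1).
  by apply: swap; rewrite mulrBr mulrBl I2 J2 opprB.
rewrite /slice_mxV /slice_mx scale_block_mx !scale_scalar_mx.
rewrite (@mulmx_block H 1 1 1 1 1 1) -!scalar_mxM -!raddfD.
rewrite !(mulr1, mul1r, mulrN) VI VJ !opprK !(addrC (- _)) -!mulrBl.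
by rewrite mulrV // !subrr !mul0r /= !raddf0 -scalar_mx_block.
Qed.

(* $G = F_{\Omega_1}^f$: the defining formula gives [G g] for every admissible
   choice of $I \ne J$. Uniqueness of such a [G] says that a choice exists for
   each [g]. *)
Definition transferred_stem Omega1 Omega2 (f : Omega2 -> H)
    (G : paths_in Omega1 -> 'cV[H]_2) : Prop :=
  forall (g : paths_in Omega1) I J
    (hI : slice_units Omega2 (\val g) I) (hJ : slice_units Omega2 (\val g) J),
    I != J ->
    G g = slice_mxV I J *m
          (col_mx (f (slice_end hI))%:M (f (slice_end hJ))%:M : 'cV[H]_(1 + 1)).

End Paths.

(* Main.v *)
Require Import Defs.
From HB Require Import structures.
From mathcomp Require Import all_boot all_order all_algebra.
From mathcomp Require Import all_classical all_reals.

Import GRing.Theory.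

Local Open Scope ring_scope.
Local Open Scope classical_set_scope.

(** For a stem function [F] of [f] and units [I != J] admissible for a path, the two stem equations
    say that the column of end values of [f] is [slice_mx I J] times the value of [F]. Inverting
    this matrix recovers that value, so the formula cannot depend on [I] and [J], and every stem
    function restricts to a solution ([restrict_stem_transferred]). Stem preservation gives each
    path two distinct units, so the formula has only one solution ([transferred_stem_uniq]). *)

Lemma card_ge2_neq {T : choiceType} (A : set T) :
  (`I_2 #<= A)%card -> exists x y, [/\ A x, A y & x != y].
Proof.
case/card_leP => g.
have m0 : (0%N : nat) \in `I_2 by rewrite inE.
have m1 : (1%N : nat) \in `I_2 by rewrite inE.
exists (\val (g (SigSub m0))), (\val (g (SigSub m1))).
split; [exact/set_mem/valP | exact/set_mem/valP |].
by apply/eqP => /val_inj/(inj (f := g) (mem_set I) (mem_set I))/(congr1 \val).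
Qed.

Section TransferredStem.
Context {R : realType} {n : nat} {Omega1 Omega2 : set 'rV[quaternion R]_n}.
Context {f : Omega2 -> quaternion R}.

Lemma restrict_stem_transferred (pres12 : stem_preserving Omega1 Omega2)
    (F : paths_in Omega2 -> 'cV[quaternion R]_2) :
  path_slice_stem f F -> transferred_stem f (restrict_paths pres12 F).
Proof.
move=> stemF g I J hI hJ neIJ; rewrite /restrict_paths /=.
set g2 := subfun _ g.
(* Both rows involve the same vector [F g2], since a stem function depends on the path and not on
   the unit. *)
have -> : col_mx (f (slice_end hI))%:M (f (slice_end hJ))%:M
    = slice_mx I J *m F g2 :> 'cV_(1 + 1).
  rewrite (stemF g2 I hI) (stemF g2 J hJ) -!mx11_scalar.
  by rewrite /slice_mx -mul_col_mx.
by rewrite mulmxA (slice_mxVK hI.1 hJ.1 neIJ) mul1mx.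
Qed.

(** The defining formula constrains the value at [g] only through a pair [I != J]; the cardinality
    condition in [pres12] supplies one. *)
Lemma transferred_stem_uniq (pres12 : stem_preserving Omega1 Omega2)
    (G G' : paths_in Omega1 -> 'cV[quaternion R]_2) :
  transferred_stem f G -> transferred_stem f G' -> G = G'.
Proof.
move=> tG tG'; apply/funext => g.
have [I [J [hI hJ neIJ]]] := card_ge2_neq _ (pres12.1 _ (set_mem (valP g))).
by rewrite (tG g I J hI hJ neIJ) (tG' g I J hI hJ neIJ).
Qed.

End TransferredStem.

Theorem proposition3p9 (R : realType) (n : nat) (n_gt0 : (0 < n)%N)
    (Omega1 Omega2 : set 'rV[quaternion R]_n)
    (cone1 : Omega1 `<=` slice_cone R n) (cone2 : Omega2 `<=` slice_cone R n)
    (conn1 : real_path_connected Omega1)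
    (pres12 : stem_preserving Omega1 Omega2)
    (f : Omega2 -> quaternion R) (psf : path_slice f) :
  exists G : paths_in Omega1 -> 'cV[quaternion R]_2,
    unique (transferred_stem f) G /\
    (forall F : paths_in Omega2 -> 'cV[quaternion R]_2,
       path_slice_stem f F -> G = restrict_paths pres12 F).
Proof.
have [F0 stemF0] := psf.
have tF0 := restrict_stem_transferred pres12 _ stemF0.
(* Any stem function [F0] serves as witness; uniqueness then identifies its restriction with that of
   every other stem function. *)
exists (restrict_paths pres12 F0); split.
  by split=> // G'; exact: (transferred_stem_uniq pres12).
move=> F stemF; apply: (transferred_stem_uniq pres12 _ _ tF0).
exact: restrict_stem_transferred.
Qed.
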